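(* Let $X$ be a vector space over $\mathbb{R}$ or $\mathbb{C}$, let $\rho : X \to [0,+\infty]$ be a modular satisfying the $\Delta_2$-condition, let $X_\rho$ be the associated modular space with its topology $\tau$, and let $F \subset X_\rho$. Then $F$ is closed for the topology $\tau$ if and only if for every sequence $(x_n)_{n \in \mathbb{N}} \subset F$ and every $x \in X_\rho$ such that $x_n \stackrel{\rho}{\longrightarrow} x$, one has $x \in F$.
   Context: A modular on a vector space $X$ over $\mathbb{R}$ or $\mathbb{C}$ is a map $\rho : X \to [0,+\infty]$ such that for all $x,y \in X$: (i) $\rho(x) = 0$ if and only if $x = 0$; (ii) $\rho(-x) = \rho(x)$ in the real case, and $\rho(e^{it}x) = \rho(x)$ for all $t \in \mathbb{R}$ in the complex case; (iii) $\rho(\alpha x + \beta y) \le \rho(x) + \rho(y)$ whenever $\alpha, \beta \ge 0$ and $\alpha + \beta = 1$. The associated modular space is $X_\rho = \{x \in X : \rho(\lambda x) \to 0 \text{ as } \lambda \to 0\}$, a vector subspace of $X$. $\Delta_2$-condition: for every sequence $(x_n)_{n \in \mathbb{N}}$ in $X_\rho$, if $\lim_{n\to\infty} \rho(x_n) = 0$ then $\lim_{n\to\infty} \rho(2x_n) = 0$. $\rho$-convergence: for $x_n, x \in X_\rho$, $x_n \stackrel{\rho}{\longrightarrow} x$ means that there exists $\lambda > 0$ such that $\rho(\lambda(x_n - x)) \to 0$ as $n \to \infty$. Topology: for $r > 0$ let $B_\rho(0,r) = \{x \in X_\rho : \rho(x) < r\}$ and let $\mathcal{B} = \{B_\rho(0,r)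 : r > 0\}$. The topology $\tau$ on $X_\rho$ is $\tau = \{G \subset X_\rho : \text{for every } x \in G \text{ there exists } V \in \mathcal{B} \text{ with } x + V \subset G\}$ (it contains $\emptyset$). A set $F \subset X_\rho$ is closed for $\tau$ if its complement in $X_\rho$ belongs to $\tau$. *)

(* Defs.v *)
(* MathComp-Analysis.  The reals are an arbitrary [R : realType], the complex
   numbers are [R[i]]. *)
From HB Require Import structures.
From mathcomp Require Import all_boot all_order all_algebra.
From mathcomp Require Import all_classical all_reals all_analysis.
From mathcomp Require Import complex.

Set Implicit Arguments.
Unset Strict Implicit.
Unset Printing Implicit Defensive.

Import Order.TTheory GRing.Theory Num.Theory.
Import numFieldNormedType.Exports.

Local Open Scope classical_set_scope.
Local Open Scope ring_scope.

(* Everything except the symmetry axiom is written once, for scalars in a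
   numFieldType [K] that is later taken to be [R] or [R[i]].  In the order of
   [R[i]], [0 <= a] (resp. [0 < a]) says that [a] is a nonnegative (resp.
   positive) real number, so these conditions have the intended meaning in both
   cases. *)

Definition premodular (R : realType) (K : numFieldType) (X : lmodType K)
    (rho : X -> \bar R) : Prop :=
  [/\ forall x : X, (0 <= rho x)%E,
      forall x : X, rho x = 0%E <-> x = 0
    & forall (x y : X) (a b : K), 0 <= a -> 0 <= b -> a + b = 1 ->
        (rho (a *: x + b *: y)%R <= rho x + rho y)%E].

Definition real_modular (R : realType) (X : lmodType R)
    (rho : X -> \bar R) : Prop :=
  premodular rho /\ forall x : X, rho (- x) = rho x.

(* [e^{it}] *)
Definition expi (R : realType) (t : R) : R[i] := Complex (cos t) (sin t).

Definition complex_modular (R : realType) (X : lmodType R[i])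
    (rho : X -> \bar R) : Prop :=
  premodular rho /\ forall (t : R) (x : X), rho (expi t *: x) = rho x.

Definition modular_space (R : realType) (K : numFieldType) (X : lmodType K)
    (rho : X -> \bar R) : set X :=
  [set x | rho (l *: x) @[l --> (0 : K)^'] --> (0 : \bar R)%E].

Definition Delta2 (R : realType) (K : numFieldType) (X : lmodType K)
    (rho : X -> \bar R) : Prop :=
  forall u : nat -> X, (forall n, modular_space rho (u n)) ->
    rho (u n) @[n --> \oo] --> (0 : \bar R)%E ->
    rho (2 *: u n) @[n --> \oo] --> (0 : \bar R)%E.

(* Used only for [u] and [x] in the modular space. *)
Definition modular_cvg (R : realType) (K : numFieldType) (X : lmodType K)
    (rho : X -> \bar R) (u : nat -> X) (x : X) : Prop :=
  exists2 l : K, 0 < l &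
    rho (l *: (u n - x)) @[n --> \oo] --> (0 : \bar R)%E.

Definition modular_ball (R : realType) (K : numFieldType) (X : lmodType K)
    (rho : X -> \bar R) (r : R) : set X :=
  [set x | modular_space rho x /\ (rho x < r%:E)%E].

Definition modular_balls (R : realType) (K : numFieldType) (X : lmodType K)
    (rho : X -> \bar R) : set (set X) :=
  [set modular_ball rho r | r in [set r : R | 0 < r]].

(* Subsets of the modular space are represented as subsets of [X] included in
   it; [modular_closed] takes the complement relative to the modular space. *)
Definition modular_topology (R : realType) (K : numFieldType)
    (X : lmodType K) (rho : X -> \bar R) : set (set X) :=
  [set G | G `<=` modular_space rho /\
    forall x, G x ->
      exists2 V, modular_balls rho V & [set x + v | v in V] `<=` G].

Definition modular_closed (R : realType) (K : numFieldType) (X : lmodType K)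
    (rho : X -> \bar R) (F : set X) : Prop :=
  modular_topology rho (modular_space rho `\` F).

(* Main.v *)
(** Iterating Delta2 turns [rho (l *: (u n - x)) --> 0] into
    [rho (2 ^+ k *: l *: (u n - x)) --> 0] with [1 <= 2 ^+ k * l], and [rho] is
    monotone along rays, so [u n - x] eventually enters every ball: a closed set
    contains the modular limits of its sequences.  Conversely, if no ball of
    radius [1 / n.+1] around a point [x] outside [F] avoids [F], points of [F]
    picked in these balls converge to [x]. *)
Require Import Defs.
From HB Require Import structures.
From mathcomp Require Import all_boot all_order all_algebra.
From mathcomp Require Import all_classical all_reals all_analysis.
From mathcomp Require Import complex.

Set Implicit Arguments.
Unset Strict Implicit.
Unset Printing Implicit Defensive.

Import Order.TTheory GRing.Theory Num.Theory.
Import numFieldNormedType.Exports.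

Local Open Scope classical_set_scope.
Local Open Scope ring_scope.

Section Modular.
Context {R : realType} {K : numFieldType} {X : lmodType K}.
Context (rho : X -> \bar R) (rho_modular : premodular rho).

(** Convexity applied to [a *: x + (1 - a) *: 0], with [rho 0 = 0]. *)
Lemma premodular_scale_le (a : K) (x : X) :
  0 <= a -> a <= 1 -> (rho (a *: x) <= rho x)%E.
Proof.
move=> a0 a1; have [_ rho0 rhoD] := rho_modular.
have b0 : 0 <= 1 - a by rewrite subr_ge0.
have := rhoD x 0 a (1 - a) a0 b0 (subrKC _ _).
by rewrite scaler0 addr0 (rho0 0).2// adde0.
Qed.

Lemma modular_spaceZ (a : K) (x : X) :
  a != 0 -> modular_space rho x -> modular_space rho (a *: x).
Proof.
move=> a_neq0 xX; rewrite /modular_space /=.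
under eq_fun do rewrite scalerA.
have al : l * a @[l --> (0 : K)^'] --> (0 : K)^'.
  move=> P P0.
  have : (l * a) @[l --> (0 : K)] --> (0 : K).
    by rewrite -[in X in _ --> X](mul0r a); apply: (@mulrr_continuous K a).
  (* [P] is a punctured neighbourhood of 0 exactly when this set is a neighbourhood of 0; since
     [a != 0], multiplication by [a] keeps nonzero scalars nonzero. *)
  move=> /(_ [set l | l != 0 -> P l] P0) Pa.
  have {}Pa : \forall l \near (0 : K), l * a != 0 -> P (l * a) by exact: Pa.
  rewrite /= !near_simpl; apply: filterS Pa => l Pl l_neq0.
  by apply: Pl; rewrite mulf_neq0.
exact: (cvg_comp _ (fun l => rho (l *: x)) al xX).
Qed.

(** [l *: (x + y)] is the midpoint of [l *: (2 *: x)] and [l *: (2 *: y)], so convexity bounds its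
    modular by a sum that tends to 0. *)
Lemma modular_spaceD (x y : X) :
  modular_space rho x -> modular_space rho y -> modular_space rho (x + y).
Proof.
move=> xX yX; have [rho_ge0 _ rhoD] := rho_modular.
have n2 : (2 : K) != 0 by rewrite pnatr_eq0.
have := cvgeD _ (modular_spaceZ n2 xX) (modular_spaceZ n2 yX).
rewrite adde0 => /(_ _ isT); rewrite /modular_space /=.
apply: (@squeeze_cvge _ _ _ _ (cst 0%E)); last exact: cvg_cst.
near=> l; rewrite rho_ge0/=.
have h0 : 0 <= 2^-1 :> K by rewrite invr_ge0 ler0n.
have h1 : 2^-1 + 2^-1 = 1 :> K by rewrite [RHS]splitr mul1r.
have := rhoD (l *: (2 *: x)) (l *: (2 *: y)) _ _ h0 h0 h1.
by rewrite -!scalerDr !scalerA mulrAC mulVf// mul1r.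
Unshelve. all: by end_near. Qed.

Lemma modular_spaceB (x y : X) :
  modular_space rho x -> modular_space rho y -> modular_space rho (x - y).
Proof.
move=> xX yX; apply: modular_spaceD => //.
by rewrite -scaleN1r; apply: modular_spaceZ; rewrite ?oppr_eq0 ?oner_eq0.
Qed.

Context (rho_Delta2 : Delta2 rho).
(** An Archimedean property, assumed here because a general [numFieldType] may fail it; it is
    established below for [R] and [R[i]]. *)
Context (archiK : forall l : K, 0 < l -> exists k, 1 <= 2 ^+ k * l).

Lemma Delta2_iter (u : nat -> X) (k : nat) :
  (forall n, modular_space rho (u n)) ->
  rho (u n) @[n --> \oo] --> (0 : \bar R)%E ->
  rho (2 ^+ k *: u n) @[n --> \oo] --> (0 : \bar R)%E.
Proof.
move=> uX u0; elim: k => [|k IH].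
  by under eq_fun do rewrite expr0 scale1r.
under eq_fun do rewrite exprS -scalerA.
by apply: rho_Delta2 IH => n; apply: modular_spaceZ.
Qed.

Lemma modular_cvg1 (u : nat -> X) (x : X) :
  (forall n, modular_space rho (u n)) -> modular_space rho x ->
  modular_cvg rho u x -> rho (u n - x) @[n --> \oo] --> (0 : \bar R)%E.
Proof.
move=> uX xX [l l0 ul]; have [rho_ge0 _ _] := rho_modular.
have [k lk] := archiK l0.
have lX n : modular_space rho (l *: (u n - x)).
  by apply: modular_spaceZ; [rewrite gt_eqF | exact: modular_spaceB].
have := Delta2_iter k lX ul.
apply: (@squeeze_cvge _ _ _ _ (cst 0%E)); last exact: cvg_cst.
near=> n; rewrite rho_ge0/= scalerA.
have lk0 : 0 < 2 ^+ k * l by exact: lt_le_trans lk.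
(* [u n - x] is its multiple by [2 ^+ k * l], scaled back by an inverse that lies in [0, 1]. *)
rewrite -[leLHS](_ : rho ((2 ^+ k * l)^-1 *: ((2 ^+ k * l) *: (u n - x))) = _).
  by apply: premodular_scale_le; rewrite ?invr_ge0 ?(ltW lk0) ?invf_le1.
by rewrite scalerA mulVf ?scale1r// gt_eqF.
Unshelve. all: by end_near. Qed.

Lemma modular_closedP (F : set X) : F `<=` modular_space rho ->
  modular_closed rho F <->
  forall (u : nat -> X) (x : X), (forall n, F (u n)) -> modular_space rho x ->
    modular_cvg rho u x -> F x.
Proof.
move=> FX; have [rho_ge0 _ _] := rho_modular; split.
  move=> [_ Fcl] u x Fu xX ux.
  apply: contrapT => nFx; have [_ [r /= r0 <-] sub] := Fcl x (conj xX nFx).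
  have u0 := modular_cvg1 (fun n => FX _ (Fu n)) xX ux.
  have [N _ /(_ N (leqnn N)) uN] :
      \forall n \near \oo, (rho (u n - x)%R < r%:E)%E.
    apply: (u0 [set y | (y < r%:E)%E]); apply: open_ereal_lt'.
    by rewrite lte_fin.
  (* [u N] is [x] plus an element of the ball, so [sub] puts it outside [F], against [Fu]. *)
  have [|_] := sub (u N); last by apply; exact: Fu.
  exists (u N - x); last by rewrite addrC subrK.
  by split=> //; apply: modular_spaceB => //; exact/FX/Fu.
move=> Fseq; split=> [x []//|x [xX nFx]]; apply: contrapT => noV; apply: nFx.
have /choice[v vP] (n : nat) : exists v,
    modular_ball rho (n.+1%:R^-1 : R) v /\ F (x + v).
  apply: contrapT => nov; apply: noV.
  exists (modular_ball rho (n.+1%:R^-1)).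
    by exists (n.+1%:R^-1) => //=; rewrite invr_gt0 ltr0n.
  move=> _ [v vB <-]; split; first exact: modular_spaceD vB.1.
  by move=> Fxv; apply: nov; exists v.
apply: (Fseq (fun n => x + v n)) => // [n|]; first by have [] := vP n.
(* The factor 1 suffices: [(x + v n) - x = v n] has modular below [n.+1%:R^-1]. *)
exists 1; first exact: ltr01.
under eq_fun do rewrite scale1r addrC addKr.
apply: (@squeeze_cvge _ _ _ _ (cst 0%E) _ (fun n => (n.+1%:R^-1)%:E)).
- by near=> n; rewrite rho_ge0/= ltW//; have [[]] := vP n.
- exact: cvg_cst.
- by apply: cvg_EFin; [near=> n | exact: cvg_harmonic].
Unshelve. all: by end_near. Qed.

End Modular.

Lemma archi_expr2 (R : realType) (l : R) : 0 < l -> exists k, 1 <= 2 ^+ k * l.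
Proof.
(* With [n] this bound, [l^-1 < n < 2 ^ n]. *)
move=> l0; exists (Num.bound l^-1).
rewrite -ler_pdivrMr// div1r ltW//.
apply: lt_le_trans (archi_boundP _) _; first by rewrite invr_ge0 ltW.
by rewrite -natrX ler_nat ltnW// ltn_expl.
Qed.

(** Positivity in [R[i]] forces a zero imaginary part, which reduces the claim to the real case. *)
Lemma archi_expr2_complex (R : realType) (l : R[i]) :
  0 < l -> exists k, 1 <= 2 ^+ k * l.
Proof.
case: l => a b; rewrite ltcE/= => /andP[/eqP -> a0].
have [k ak] := archi_expr2 a0; exists k.
have -> : (2 ^+ k * Complex a 0 : R[i]) = (2 ^+ k * a)%:C%C.
  by rewrite rmorphM rmorphXn rmorph_nat.
by rewrite lecE/= eqxx.
Qed.

Theorem mainTheorem3 (R : realType) :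
  (forall (X : lmodType R) (rho : X -> \bar R) (F : set X),
     real_modular rho -> Delta2 rho -> F `<=` modular_space rho ->
     (modular_closed rho F <->
      forall (u : nat -> X) (x : X),
        (forall n, F (u n)) -> modular_space rho x ->
        modular_cvg rho u x -> F x)) /\
  (forall (X : lmodType R[i]) (rho : X -> \bar R) (F : set X),
     complex_modular rho -> Delta2 rho -> F `<=` modular_space rho ->
     (modular_closed rho F <->
      forall (u : nat -> X) (x : X),
        (forall n, F (u n)) -> modular_space rho x ->
        modular_cvg rho u x -> F x)).
Proof.
split=> X rho F [rho_mod _] rho_D2 FX.
  by apply: modular_closedP => //; exact: archi_expr2.
by apply: modular_closedP => //; exact: archi_expr2_complex.
Qed.
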